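(* Let $m\ge1$ and $p\ge 1$, and for a $p$-variate time series $\boldsymbol x=(\boldsymbol x_t)$ let $\boldsymbol G_m(\boldsymbol x)$ be the cumulative generalized kurtosis matrix $$\boldsymbol G_m(\boldsymbol x)=\sum_{l=1}^m\sum_{i=1}^p\sum_{j=1}^p\mathrm{cov}^2(\boldsymbol x_t\boldsymbol x_t^T,x_{t-l,i}x_{t-l,j}).$$ (i) $\boldsymbol G_m$ is orthogonal equivariant, i.e., for any $p$-variate $\boldsymbol x$ and any $p\times p$ orthogonal matrix $\boldsymbol V$, $$\boldsymbol G_m(\boldsymbol V\boldsymbol x)=\boldsymbol V\boldsymbol G_m(\boldsymbol x)\boldsymbol V^T.$$ (ii) $\boldsymbol G_m$ has the independence property, i.e., if $\boldsymbol s=(\boldsymbol s_t)$ is a $p$-variate time series with $\mathrm E(\boldsymbol s_t)=\boldsymbol 0$ whose component time series are mutually independent, then $\boldsymbol G_m(\boldsymbol s)$ is a diagonal matrix.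
   Context: Time series are stationary with finite fourth moments, so that all the covariances exist and do not depend on $t$. For a random $p\times p$ matrix $\boldsymbol A$ and a random scalar $y$, $\mathrm{cov}(\boldsymbol A,y)$ is the $p\times p$ matrix with entries $\mathrm{cov}(A_{jk},y)$, and $\mathrm{cov}^2(\boldsymbol A,y)=\mathrm{cov}(\boldsymbol A,y)\,\mathrm{cov}(\boldsymbol A,y)^T$. $\boldsymbol V\boldsymbol x$ denotes the series $(\boldsymbol V\boldsymbol x_t)$, and $x_{t,i}$ is the $i$th component of $\boldsymbol x_t$. *)

(* Defs.v *)
From HB Require Import structures.
From mathcomp Require Export all_boot all_order all_algebra.
From mathcomp Require Export all_classical all_reals all_analysis.

Set Implicit Arguments.
Unset Strict Implicit.
Unset Printing Implicit Defensive.

Import Order.TTheory GRing.Theory Num.Theory.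
Import numFieldNormedType.Exports.

Local Open Scope classical_set_scope.
Local Open Scope ring_scope.

(* A p-variate time series is a family x : int -> T -> 'cV[R]_p of random
   vectors on a probability space (T, P), with time ranging over all of Z. *)

Definition component (R : realType) (T : Type) (p : nat)
    (x : int -> T -> 'cV[R]_p) (t : int) (i : 'I_p) : T -> R :=
  fun w => x t w i 0.

(* Strict stationarity: shifting time by h changes no finite-dimensional
   distribution.  Each q_k is a pair (time, component index), so vectors
   x_{t_1}, ..., x_{t_r} are covered by listing all their components. *)
Definition strictly_stationary d (T : measurableType d) (R : realType)
    (P : probability T R) (p : nat) (x : int -> T -> 'cV[R]_p) : Prop :=
  forall (n : nat) (q : 'I_n -> int * 'I_p) (h : int)
      (B : set (n.-tuple (measurableTypeR R))),
    measurable B ->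
    P [set w | B [tuple component x (q k).1 (q k).2 w | k < n]] =
    P [set w | B [tuple component x ((q k).1 + h) (q k).2 w | k < n]].

Record is_time_series d (T : measurableType d) (R : realType)
    (P : probability T R) (p : nat) (x : int -> T -> 'cV[R]_p) : Prop := {
  ts_measurable : forall t i, measurable_fun setT (component x t i) ;
  ts_stationary : strictly_stationary P x ;
  ts_moment4 : forall t i,
    ('E_P[fun w => (component x t i w ^+ 4)%R] < +oo)%E }.

Definition orthogonal_mx (R : realType) (p : nat) (V : 'M[R]_p) : Prop :=
  V *m V^T = 1%:M.

Definition mulmx_series (R : realType) (T : Type) (p : nat)
    (V : 'M[R]_p) (x : int -> T -> 'cV[R]_p) : int -> T -> 'cV[R]_p :=
  fun t w => V *m x t w.

(* [covariance] is extended-real valued; [fine] is harmless here because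
   finite fourth moments make every covariance used below finite. *)
Definition cov_mx d (T : measurableType d) (R : realType)
    (P : probability T R) (p : nat) (A : T -> 'M[R]_p) (y : T -> R) :
    'M[R]_p :=
  \matrix_(j, k) fine (covariance P (fun w => A w j k) y).

Definition cov2_mx d (T : measurableType d) (R : realType)
    (P : probability T R) (p : nat) (A : T -> 'M[R]_p) (y : T -> R) :
    'M[R]_p :=
  cov_mx P A y *m (cov_mx P A y)^T.

(* The time t is kept as an argument; for a stationary x with finite fourth
   moments the value does not depend on it. *)
Definition cum_kurtosis d (T : measurableType d) (R : realType)
    (P : probability T R) (p m : nat) (x : int -> T -> 'cV[R]_p) (t : int) :
    'M[R]_p :=
  \sum_(1 <= l < m.+1) \sum_(i < p) \sum_(j < p)
    cov2_mx P (fun w => x t w *m (x t w)^T)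
      (fun w => component x (t - l%:Z) i w * component x (t - l%:Z) j w).

Definition centered d (T : measurableType d) (R : realType)
    (P : probability T R) (p : nat) (s : int -> T -> 'cV[R]_p) : Prop :=
  forall t i, ('E_P[component s t i] = 0)%E.

(* The sigma-algebra generated by the whole i-th component series. *)
Definition component_events d (T : measurableType d) (R : realType)
    (p : nat) (s : int -> T -> 'cV[R]_p) (i : 'I_p) : set (set T) :=
  <<s \bigcup_(t in [set: int])
        preimage_set_system setT (component s t i)
          (measurable : set (set (measurableTypeR R))) >>.

Definition independent_components d (T : measurableType d) (R : realType)
    (P : probability T R) (p : nat) (s : int -> T -> 'cV[R]_p) : Prop :=
  forall (J : {set 'I_p}) (A : 'I_p -> set T),
    (forall i, i \in J -> component_events s i (A i)) ->
    P (\bigcap_(i in [set` J]) A i) = (\prod_(i in J) P (A i))%E.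

(* Main.v *)
Require Import Defs.
From mathcomp Require Import measurable_realfun lra.
Import Order.TTheory GRing.Theory Num.Theory.
Local Open Scope classical_set_scope.
Local Open Scope ring_scope.

(** Write [c(j,k;a,b)] for the covariance of [x_{t,j} x_{t,k}] and
    [x_{u,a} x_{u,b}], with [u = t - l], and [C_{ab}] for the matrix
    [(c(j,k;a,b))_{jk}], so that the lag-[l] part of the kurtosis matrix is
    [sum_{a,b} C_{ab} C_{ab}^T].  Products of two variables with a fourth moment
    are square integrable, hence all these covariances are finite and bilinear.

    Equivariance.  Replacing [x] by [V x] turns [C_{ij}] into
    [V (sum_{a,b} V_{ia} V_{jb} C_{ab}) V^T] ([cov_mx_mulmx_series]).  The
    coefficients [V_{ia} V_{jb}] form the matrix of [V (x) V], which is
    orthogonal on pairs of indices ([orthogonal_tensor]), and a sum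
    [sum_q C_q C_q^T] does not change when the family [C] is replaced by its
    image under an orthogonal matrix of coefficients ([sum_isometry]).  The outer
    factors [V^T V] cancel.

    Diagonality.  For centered independent components, [c(j,r;a,b)] vanishes
    unless the multisets [{j,r}] and [{a,b}] coincide ([covariance_unpaired]):
    an index occurring only once makes both terms of
    [E(s_j s_r s_a s_b) - E(s_j s_r) E(s_a s_b)] vanish, and if there is none and
    the multisets differ, then [j = r], [a = b], and [s_j^2] is independent of
    [s_a^2] because [a != j].  The entry [(j,k)] of the kurtosis matrix is a sum of products
    [c(j,r;a,b) c(k,r;a,b)], and both factors can be nonzero only if
    [{j,r} = {k,r}], that is [j = k].

    The probabilistic input is that the expectation of a product factorizes when
    one factor depends on the series [s_i] alone and the other on the remaining
    component series ([expectationM_components]).  Independence is given for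
    events of the single components; a pi-lambda argument extends it to the
    sigma-algebra of all components other than [i] ([indep_other_events]), and
    then the joint law of the two factors is a product measure, so that Fubini's
    theorem applies ([expectationM_indep]). *)

(** * Fourth moments and covariances *)

Section moments.
Local Set Implicit Arguments.
Local Unset Strict Implicit.
Context {d : measure_display} {T : measurableType d} {R : realType}.
Context (P : probability T R).

Definition moment4 (X : T -> R) : Prop :=
  measurable_fun setT X /\ ('E_P[fun w => (X w ^+ 4)%R] < +oo)%E.

Lemma moment4_cst (c : R) : moment4 (cst c).
Proof.
split; first exact: measurable_cst.
by rewrite (_ : (fun _ => _) = cst (c ^+ 4)) // expectation_cst ltry.
Qed.

Lemma moment4_integrable (X : T -> R) : moment4 X ->
  P.-integrable setT (EFin \o (fun w => X w ^+ 4)).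
Proof.
move=> [mX]; rewrite unlock => X4; apply/integrableP; split.
  by apply/measurable_EFinP; exact: measurable_funX.
apply: le_lt_trans X4; apply: ge0_le_integral => //.
- by apply: measurableT_comp => //; apply/measurable_EFinP; exact: measurable_funX.
- by apply/measurable_EFinP; exact: measurable_funX.
- by move=> w _; rewrite /= ger0_norm// exprn_even_ge0.
Qed.

Lemma Lfun2_of_sqr (X : T -> R) : measurable_fun setT X ->
  P.-integrable setT (EFin \o (fun w => X w ^+ 2)) -> X \in Lfun P 2%:E.
Proof.
move=> mX /integrableP[_ iX]; apply/andP; split; rewrite inE//=.
rewrite /finite_norm unlock/=; apply: poweR_lty.
apply: le_lt_trans iX; rewrite le_eqVlt; apply/orP; left; apply/eqP.
by apply: eq_integral => w _; rewrite /= powR_mulrn// normrX.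
Qed.

(** Since [(x y)^2 <= x^4 + y^4]. *)
Lemma moment4_mul (X Y : T -> R) : moment4 X -> moment4 Y ->
  (fun w => X w * Y w) \in Lfun P 2%:E.
Proof.
move=> X4 Y4; have mXY := measurable_funM X4.1 Y4.1.
apply: Lfun2_of_sqr; first exact: mXY.
have := integrableD measurableT (moment4_integrable X4) (moment4_integrable Y4).
apply: le_integrable => //.
  by apply/measurable_EFinP; exact: measurable_funX.
move=> w _; rewrite /= lee_fin !ger0_norm ?addr_ge0 ?sqr_ge0 ?exprn_even_ge0//.
have := sqr_ge0 (X w ^+ 2 - Y w ^+ 2); nra.
Qed.

Lemma Lfun2_Lfun1 (X : T -> R) : X \in Lfun P 2%:E -> X \in Lfun P 1.
Proof. by apply: Lfun_subset12; exact: fin_num_measure. Qed.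

Lemma moment4_mul4 (X Y Z W : T -> R) :
  moment4 X -> moment4 Y -> moment4 Z -> moment4 W ->
  (fun w => (X w * Y w) * (Z w * W w)) \in Lfun P 1.
Proof. by move=> *; apply: Lfun2_mul_Lfun1; exact: moment4_mul. Qed.

Lemma fine_covarianceE (X Y : T -> R) :
  X \in Lfun P 2%:E -> Y \in Lfun P 2%:E ->
  fine (covariance P X Y) =
    fine 'E_P[fun w => (X w * Y w)%R] - fine 'E_P[X] * fine 'E_P[Y].
Proof.
move=> X2 Y2; have XY := Lfun2_mul_Lfun1 X2 Y2.
have [X1 Y1] := (Lfun2_Lfun1 X2, Lfun2_Lfun1 Y2).
rewrite covarianceE// fineB ?fin_numM ?expectation_fin_num// fineM//;
  exact: expectation_fin_num.
Qed.

Lemma Lfun2_lincomb (I : Type) (c : I -> R) (X : I -> T -> R) :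
  (forall i, X i \in Lfun P 2%:E) ->
  (forall i, (fun w => c i * X i w) \in Lfun P 2%:E) /\
  (forall r, (fun w => \sum_(i <- r) c i * X i w) \in Lfun P 2%:E).
Proof.
move=> X2; have cX2 i : (fun w => c i * X i w) \in Lfun P 2%:E.
  rewrite (_ : (fun _ => _) = c i \o* X i); last first.
    by apply/funext => w /=; rewrite mulrC.
  by apply: Lfun_scale; rewrite ?X2// ler1n.
split=> // r.
rewrite (_ : (fun _ => _) = \sum_(i <- r) (fun w => c i * X i w)); last first.
  by apply/funext => w; rewrite fct_sumE.
by apply: rpred_sum => //; rewrite lee1n.
Qed.

(** Square integrability keeps all the extended-real covariances finite, so that
    taking real values commutes with the sum. *)
Lemma covariance_suml (I : Type) (r : seq I) (c : I -> R) (X : I -> T -> R)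
    (Y : T -> R) :
  (forall i, X i \in Lfun P 2%:E) -> Y \in Lfun P 2%:E ->
  fine (covariance P (fun w => \sum_(i <- r) c i * X i w) Y) =
  \sum_(i <- r) c i * fine (covariance P (X i) Y).
Proof.
move=> X2 Y2.
have [cX2 S2] := Lfun2_lincomb c X2.
have fin Z W : Z \in Lfun P 2%:E -> W \in Lfun P 2%:E -> covariance P Z W \is a fin_num.
  by move=> Z2 W2; apply: covariance_fin_num;
    [exact: Lfun2_Lfun1..|exact: Lfun2_mul_Lfun1].
elim: r => [|i r IH].
  rewrite big_nil (_ : (fun _ => _) = cst 0); last by apply/funext => w; rewrite big_nil.
  by rewrite covariance_cst_l.
rewrite big_cons -IH.
rewrite (_ : (fun _ => _) =
   (fun w => c i * X i w) \+ (fun w => \sum_(i <- r) c i * X i w)); last first.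
  by apply/funext => w; rewrite big_cons.
rewrite covarianceDl// fineD ?fin//; congr (_ + _).
rewrite (_ : (fun _ => _) = c i \o* X i); last by apply/funext => w /=; rewrite mulrC.
rewrite covarianceZl ?fineM ?fin//; [exact: Lfun2_Lfun1..|exact: Lfun2_mul_Lfun1].
Qed.

Lemma covariance_sumr (I : Type) (r : seq I) (c : I -> R) (X : I -> T -> R)
    (Y : T -> R) :
  (forall i, X i \in Lfun P 2%:E) -> Y \in Lfun P 2%:E ->
  fine (covariance P Y (fun w => \sum_(i <- r) c i * X i w)) =
  \sum_(i <- r) c i * fine (covariance P Y (X i)).
Proof.
move=> X2 Y2; rewrite covarianceC covariance_suml//.
by under eq_bigr do rewrite covarianceC.
Qed.
End moments.

(** * Expectation of a product of independent variables *)

Section independent_product.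
Local Set Implicit Arguments.
Local Unset Strict Implicit.
Context {d : measure_display} {T : measurableType d} {R : realType}.
Context (P : probability T R).

(** The joint law of [X] and [Y] agrees with the product of their laws on
    rectangles, hence everywhere, and the integral of [x * y] against the product
    measure splits by Fubini's theorem. *)
Lemma expectationM_indep (X Y : T -> R) :
  measurable_fun setT X -> measurable_fun setT Y ->
  (forall A B : set (measurableTypeR R), measurable A -> measurable B ->
    P (X @^-1` A `&` Y @^-1` B) = (P (X @^-1` A) * P (Y @^-1` B))%E) ->
  X \in Lfun P 1 -> Y \in Lfun P 1 -> (fun w => X w * Y w) \in Lfun P 1 ->
  ('E_P[fun w => (X w * Y w)%R] = 'E_P[X] * 'E_P[Y])%E.
Proof.
move=> mX mY XY X1 Y1 XY1.
pose X' : {mfun T >-> R} := mfun_Sub (mem_set mX).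
pose Y' : {mfun T >-> R} := mfun_Sub (mem_set mY).
pose XY' w : R * R := (X' w, Y' w).
have mXY' : measurable_fun setT XY' by apply/measurable_fun_pairP; split.
pose f (z : R * R) : \bar R := (z.1 * z.2)%:E.
have mf : measurable_fun setT f.
  by apply/measurable_EFinP; apply: measurable_funM.
pose mu := pushforward P XY'.
pose muX := distribution P X'; pose muY := distribution P Y'.
have muE A : measurable A -> (muX \x muY)%E A = mu A.
  apply: product_measure_unique => B C mB mC /=.
  by rewrite /mu /pushforward -XY.
have if' : P.-integrable setT (f \o XY') by exact/Lfun1_integrable.
have iX : P.-integrable setT (EFin \o X) by exact/Lfun1_integrable.
have iY : P.-integrable setT (EFin \o Y) by exact/Lfun1_integrable.
have intf : mu.-integrable setT f.
  by apply: integrable_pushforward.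
have intf' : (muX \x muY)%E.-integrable setT f.
  apply/integrableP; split => //; have /integrableP[_] := intf.
  by rewrite -(eq_measure_integral mu (m1 := (muX \x muY)%E)) => // A mA _; exact: muE.
rewrite unlock; transitivity (\int[mu]_z f z)%E.
  by rewrite integral_pushforward.
rewrite -(eq_measure_integral mu (m1 := (muX \x muY)%E)); last first.
  by move=> A mA _; exact: muE.
rewrite -integral12_prod_meas1// /fubini_F/f/=.
have EY : (\int[P]_w (Y w)%:E = \int[muY]_y y%:E)%E.
  by rewrite integral_distribution.
have EX : (\int[P]_w (X w)%:E = \int[muX]_x x%:E)%E.
  by rewrite integral_distribution.
have iY' : muY.-integrable setT EFin by apply: integrable_pushforward.
have iX' : muX.-integrable setT EFin by apply: integrable_pushforward.
under eq_integral => x _.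
  under eq_integral do rewrite EFinM.
  rewrite integralZl//.
  over.
rewrite EX EY /=.
have fY := integrable_fin_num measurableT iY'.
by rewrite -{1}(fineK fY) integralZr// fineK.
Qed.
End independent_product.

(** * The quadratic structure of the kurtosis matrix *)

Section series.
Local Set Implicit Arguments.
Local Unset Strict Implicit.
Context {T : Type} {R : realType} {p : nat}.
Implicit Types (x : int -> T -> 'cV[R]_p) (V : 'M[R]_p).

Definition cross x t i j : T -> R :=
  fun w => component x t i w * component x t j w.

Lemma crossC x t i j : cross x t i j = cross x t j i.
Proof. by apply/funext => w; exact: mulrC. Qed.

Lemma outer_crossE x t i j :
  (fun w => (x t w *m (x t w)^T) i j) = cross x t i j.
Proof. by apply/funext => w; rewrite !mxE big_ord1 !mxE. Qed.

Lemma cross_mulmx V x t i j :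
  cross (mulmx_series V x) t i j =
  fun w => \sum_(q : 'I_p * 'I_p) (V i q.1 * V j q.2) * cross x t q.1 q.2 w.
Proof.
apply/funext => w; rewrite /cross /component /mulmx_series !mxE.
rewrite big_distrlr/= pair_big/=; apply: eq_bigr => q _.
by rewrite mulrACA.
Qed.

(** Expanding the square, the coefficient of [C_q C_{q'}^T] is the inner product
    of the columns [q] and [q'] of [W]. *)
Lemma sum_isometry (I J : finType) (W : I -> J -> R) (C : J -> 'M[R]_p) :
  (forall q q', \sum_r W r q * W r q' = (q == q')%:R) ->
  \sum_r (\sum_q W r q *: C q) *m (\sum_q W r q *: C q)^T =
  \sum_q C q *m (C q)^T.
Proof.
move=> orthW.
under eq_bigr => r _.
  rewrite mulmx_suml.
  under eq_bigr => q _.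
    rewrite linear_sum mulmx_sumr.
    under eq_bigr => q' _ do
      rewrite linearZ/= -scalemxAr -scalemxAl scalerA mulrC.
    over.
  over.
rewrite exchange_big; apply: eq_bigr => q _ /=.
rewrite exchange_big (bigD1 q)//= -scaler_suml orthW eqxx scale1r.
rewrite big1 ?addr0// => q' q'q.
by rewrite -scaler_suml orthW eq_sym (negPf q'q) scale0r.
Qed.

(** The Kronecker square of an orthogonal matrix is orthogonal: the sum over
    pairs of rows factors into two inner products of columns of [V]. *)
Lemma orthogonal_tensor V : orthogonal_mx V ->
  forall q q' : 'I_p * 'I_p,
  \sum_(r : 'I_p * 'I_p) (V r.1 q.1 * V r.2 q.2) * (V r.1 q'.1 * V r.2 q'.2) =
  (q == q')%:R.
Proof.
move=> /mulmx1C VV [a b] [a' b'] /=.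
have orthV c c' : \sum_i V i c * V i c' = (c == c')%:R.
  have /matrixP/(_ c c') := VV; rewrite !mxE => <-.
  by apply: eq_bigr => i _; rewrite mxE.
rewrite (eq_bigr (fun r => (V r.1 a * V r.1 a') * (V r.2 b * V r.2 b'))); last first.
  by move=> r _; rewrite mulrACA.
rewrite -(pair_big xpredT xpredT
  (fun i j => (V i a * V i a') * (V j b * V j b')))/=.
by rewrite -big_distrlr/= !orthV -natrM mulnb xpair_eqE.
Qed.
End series.

(** * Orthogonal equivariance *)

Section equivariance.
Local Set Implicit Arguments.
Local Unset Strict Implicit.
Context {d : measure_display} {T : measurableType d} {R : realType}.
Context (P : probability T R) (p : nat).
Implicit Types (x : int -> T -> 'cV[R]_p) (V : 'M[R]_p).

(** The components of [V x_t] contribute the two outer factors [V], those of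
    [V x_u] the coefficients of the sum. *)
Lemma cov_mx_mulmx_series x V t u i j :
  (forall v k, moment4 P (component x v k)) ->
  cov_mx P (fun w => mulmx_series V x t w *m (mulmx_series V x t w)^T)
    (cross (mulmx_series V x) u i j) =
  V *m (\sum_(q : 'I_p * 'I_p) (V i q.1 * V j q.2) *:
     cov_mx P (fun w => x t w *m (x t w)^T) (cross x u q.1 q.2)) *m V^T.
Proof.
move=> x4; have x2 v k l : cross x v k l \in Lfun P 2%:E by exact: moment4_mul.
apply/matrixP => k l; rewrite mxE outer_crossE !cross_mulmx.
have S2 : (fun w => \sum_(q : 'I_p * 'I_p) (V i q.1 * V j q.2) * cross x u q.1 q.2 w)
    \in Lfun P 2%:E.
  by apply: (Lfun2_lincomb _ _).2 => q; exact: x2.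
rewrite covariance_suml//.
transitivity (\sum_(q : 'I_p * 'I_p) \sum_(q' : 'I_p * 'I_p)
  V k q.1 * V l q.2 * ((V i q'.1 * V j q'.2) *
   fine (covariance P (cross x t q.1 q.2) (cross x u q'.1 q'.2)))).
  by apply: eq_bigr => q _; rewrite covariance_sumr// mulr_sumr.
rewrite -(pair_big xpredT xpredT (fun a b => \sum_(q' : 'I_p * 'I_p)
  V k a * V l b * ((V i q'.1 * V j q'.2) *
   fine (covariance P (cross x t a b) (cross x u q'.1 q'.2)))))/=.
rewrite exchange_big mxE; apply: eq_bigr => b _ /=.
rewrite !mxE mulr_suml; apply: eq_bigr => a _.
rewrite summxE -mulr_sumr -!mulrA; congr (_ * _).
rewrite mulrC; congr (_ * _); apply: eq_bigr => q _.
by rewrite !mxE outer_crossE.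
Qed.

Lemma cum_kurtosis_crossE m x t : cum_kurtosis P m x t =
  \sum_(1 <= l < m.+1) \sum_(q : 'I_p * 'I_p)
    cov2_mx P (fun w => x t w *m (x t w)^T) (cross x (t - l%:Z) q.1 q.2).
Proof. by apply: eq_bigr => l _; rewrite pair_big. Qed.

Lemma cum_kurtosis_equivariant m x V t :
  (forall v k, moment4 P (component x v k)) -> orthogonal_mx V ->
  cum_kurtosis P m (mulmx_series V x) t = V *m cum_kurtosis P m x t *m V^T.
Proof.
move=> x4 oV; rewrite !cum_kurtosis_crossE mulmx_sumr mulmx_suml.
apply: eq_bigr => l _; have VV := mulmx1C oV.
rewrite /cov2_mx -[X in V *m X](sum_isometry _ (orthogonal_tensor oV)).
rewrite mulmx_sumr mulmx_suml.
apply: eq_bigr => r _; rewrite cov_mx_mulmx_series//.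
by rewrite !trmx_mul trmxK -!mulmxA (mulmxA V^T V) VV mul1mx.
Qed.
End equivariance.

(** * Independent components *)

Section independence.
Local Set Implicit Arguments.
Local Unset Strict Implicit.
Context {d : measure_display} {T : measurableType d} {R : realType}.
Context (P : probability T R).

(** Measurability for a sub-sigma-algebra is expressed on the copy of [T] that
    carries the sigma-algebra generated by [F], so that closure under products is
    inherited from the general theory of measurable functions. *)
Definition sigma_measurable (F : set (set T)) (X : T -> R) : Prop :=
  measurable_fun [set: g_sigma_algebraType F] (X : g_sigma_algebraType F -> R).

Lemma sigma_measurableM F X Y :
  sigma_measurable F X -> sigma_measurable F Y ->
  sigma_measurable F (fun w => X w * Y w).
Proof. by move=> mX mY; exact: (measurable_funM mX mY). Qed.

Lemma sigma_measurable_preimage F X (B : set (measurableTypeR R)) :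
  sigma_measurable F X -> measurable B -> <<s F >> (X @^-1` B).
Proof. by move=> mX mB; rewrite -[_ @^-1` _]setTI; exact: mX. Qed.

Context (p : nat).
Implicit Types (s : int -> T -> 'cV[R]_p) (i j : 'I_p).

Definition component_gen s i : set (set T) :=
  \bigcup_(t in [set: int]) preimage_set_system setT (component s t i)
    (measurable : set (set (measurableTypeR R))).

Definition other_events s i : set (set T) :=
  \bigcup_(q in [set q | q != i]) component_events s q.

Lemma component_sigma_measurable s t i :
  sigma_measurable (component_gen s i) (component s t i).
Proof.
move=> _ B mB; apply: sub_sigma_algebra; exists t => //.
by exists B.
Qed.

Lemma component_other_measurable s t i j : j != i ->
  sigma_measurable (other_events s i) (component s t j).
Proof.
move=> ji _ B mB; apply: sub_sigma_algebra; exists j => //.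
exact: component_sigma_measurable.
Qed.

Lemma component_events_measurable s i :
  (forall t, measurable_fun setT (component s t i)) ->
  component_events s i `<=` measurable.
Proof.
move=> ms; apply: smallest_sub; first exact: sigma_algebra_measurable.
by move=> _ [t _ [B mB <-]]; exact: ms.
Qed.

(** Fix [A].  The finite measures [P(. /\ A)] and [P(A) P(.)] agree on the
    intersections of one event per component other than [i], by independence.
    These intersections form a pi-system generating the sigma-algebra of the
    other components, so the two measures agree there. *)
Lemma indep_other_events s i (A B : set T) :
  (forall t j, measurable_fun setT (component s t j)) ->
  independent_components P s ->
  component_events s i A -> <<s other_events s i >> B ->
  P (A `&` B) = (P A * P B)%E.
Proof.
move=> ms ind sA.
have mev j : component_events s j `<=` measurable.
  by apply: component_events_measurable => t; exact: ms.
have mA := mev i A sA.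
have evT j : component_events s j setT.
  exact: (@measurableT _ (g_sigma_algebraType (component_gen s j))).
have evI j (C D : set T) : component_events s j C -> component_events s j D ->
    component_events s j (C `&` D).
  exact: (@measurableI _ (g_sigma_algebraType (component_gen s j))).
(* Filling up with [setT] shows every event of a single component other than [i]
   to be such an intersection. *)
pose G : set (set T) :=
  [set \bigcap_(j in [set` [set~ i]%SET]) C j | C in
     [set C : 'I_p -> set T | forall j, component_events s j (C j)]].
have mG : G `<=` measurable.
  move=> _ [C sC <-]; apply: fin_bigcap_measurable => // j _.
  exact: mev.
have GT : G setT.
  by exists (fun=> setT); [move=> j; exact: evT | exact: bigcapT].
have GI : setI_closed G.
  move=> _ _ [C sC <-] [D sD <-]; exists (fun j => C j `&` D j).
    by move=> j; exact: evI.
  by rewrite bigcapI.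
have subG : <<s other_events s i >> `<=` <<s G >>.
  apply: smallest_sub; first exact: smallest_sigma_algebra.
  move=> C [j ji sC]; apply: sub_sigma_algebra.
  exists (fun k => if k == j then C else setT) => [k|].
    by case: eqP => [->|].
  apply/seteqP; split=> [w /(_ j)|w Cw k _]; last by case: ifP.
  by rewrite eqxx; apply; rewrite /= !inE.
have PA : (0 <= fine (P A)) by exact: fine_ge0.
move=> /subG; rewrite setIC.
(* The constant sequence [setT] is the cover by sets of finite measure. *)
have := @g_sigma_algebra_measure_unique _ R T G mG (fun=> setT) (fun=> GT) _
  (mrestr P mA) (mscale (NngNum PA) P) GI _ _ B.
rewrite /= /mrestr /mscale /= fineK ?fin_num_measure//; apply.
- exact: bigcup_const.
- move=> _ [C sC <-].
  (* Both sides become instances of independence for the single family [D]. *)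
  pose D j := if j == i then A else C j.
  have sD j : component_events s j (D j) by rewrite /D; case: eqP => [->|].
  have DC : \bigcap_(j in [set` [set~ i]%SET]) D j =
            \bigcap_(j in [set` [set~ i]%SET]) C j.
    apply: eq_bigcapr => j /=; rewrite !inE /D => ji.
    by rewrite (negPf ji).
  have -> : \bigcap_(j in [set` [set~ i]%SET]) C j `&` A =
            \bigcap_(j in [set` [set: 'I_p]%SET]) D j.
    rewrite -DC; apply/seteqP; split=> [w [Cw Aw] j _|w Dw]; last first.
      by split=> [j _|]; [apply: Dw | have := Dw i; rewrite /D eqxx; apply];
        rewrite /= inE.
    have [->|ji] := eqVneq j i; first by rewrite /D eqxx.
    by apply: Cw; rewrite /= !inE.
  rewrite -DC !ind// (bigD1 i) ?inE//= {1}/D eqxx; congr (_ * _)%E.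
  by apply: eq_bigl => j; rewrite !inE.
- by move=> _; rewrite setTI ltey_eq fin_num_measure.
Qed.

Lemma expectationM_components s i (X Y : T -> R) :
  (forall t j, measurable_fun setT (component s t j)) ->
  independent_components P s ->
  sigma_measurable (component_gen s i) X ->
  sigma_measurable (other_events s i) Y ->
  X \in Lfun P 1 -> Y \in Lfun P 1 -> (fun w => X w * Y w) \in Lfun P 1 ->
  ('E_P[fun w => (X w * Y w)%R] = 'E_P[X] * 'E_P[Y])%E.
Proof.
move=> ms ind mX mY X1 Y1 XY1.
have mfun Z : Z \in Lfun P 1 -> measurable_fun setT Z.
  by move=> /Lfun1_integrable/measurable_int/measurable_EFinP.
apply: (expectationM_indep (mfun _ X1) (mfun _ Y1)) => // A B mA mB.
apply: (@indep_other_events s i) => //.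
- exact: (@sigma_measurable_preimage (component_gen s i)).
- exact: sigma_measurable_preimage.
Qed.

Context (s : int -> T -> 'cV[R]_p).
Context (ts : is_time_series P s) (ind : independent_components P s)
  (cs : centered P s).

Lemma moment4_component t i : moment4 P (component s t i).
Proof. by split; [exact: ts_measurable ts _ _|exact: ts_moment4 ts _ _]. Qed.

(** An index occurring only once splits off a factor of mean zero.  Variables with
    fewer than four factors are seen to be integrable by completing the product
    with constants [1]. *)
Lemma expectation_single4 t1 t2 t3 t4 i j k l :
  j != i -> k != i -> l != i ->
  ('E_P[fun w => (component s t1 i w * component s t2 j w *
     (component s t3 k w * component s t4 l w))%R] = 0)%E.
Proof.
move=> ji ki li; pose x := component s.
pose one : T -> R := cst 1.
have M4 := moment4_component; have M1 : moment4 P one := moment4_cst P 1.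
rewrite (_ : (fun w => _) =
    fun w => x t1 i w * (x t2 j w * (x t3 k w * x t4 l w))); last first.
  by apply/funext => w; rewrite -mulrA.
rewrite (expectationM_components (i := i) (ts_measurable ts) ind).
- by rewrite cs mul0e.
- exact: component_sigma_measurable.
- by do !apply: sigma_measurableM; exact: component_other_measurable.
- have := moment4_mul4 (M4 t1 i) M1 M1 M1.
  by under eq_fun do rewrite /one /= !mulr1.
- have := moment4_mul4 M1 (M4 t2 j) (M4 t3 k) (M4 t4 l).
  by under eq_fun do rewrite /one /= mul1r.
- have := moment4_mul4 (M4 t1 i) (M4 t2 j) (M4 t3 k) (M4 t4 l).
  by under eq_fun do rewrite -mulrA.
Qed.

Lemma expectation_single2 t1 t2 i j : j != i ->
  ('E_P[fun w => (component s t1 i w * component s t2 j w)%R] = 0)%E.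
Proof.
move=> ji; pose x := component s.
pose one : T -> R := cst 1.
have M4 := moment4_component; have M1 : moment4 P one := moment4_cst P 1.
rewrite (expectationM_components (i := i) (ts_measurable ts) ind).
- by rewrite cs mul0e.
- exact: component_sigma_measurable.
- exact: component_other_measurable.
- have := moment4_mul4 (M4 t1 i) M1 M1 M1.
  by under eq_fun do rewrite /one /= !mulr1.
- have := moment4_mul4 (M4 t2 j) M1 M1 M1.
  by under eq_fun do rewrite /one /= !mulr1.
- have := moment4_mul4 (M4 t1 i) (M4 t2 j) M1 M1.
  by under eq_fun do rewrite /one /= !mulr1.
Qed.

Lemma cross_Lfun2 t i j : cross s t i j \in Lfun P 2%:E.
Proof. by apply: moment4_mul; exact: moment4_component. Qed.

Lemma covariance_single t u j r a b : r != j -> a != j -> b != j ->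
  fine (covariance P (cross s t j r) (cross s u a b)) = 0.
Proof.
move=> rj aj bj; rewrite fine_covarianceE; [|exact: cross_Lfun2..].
by rewrite expectation_single4// expectation_single2//= mul0r subr0.
Qed.

Lemma covariance_distinct t u j a : a != j ->
  fine (covariance P (cross s t j j) (cross s u a a)) = 0.
Proof.
move=> aj; rewrite fine_covarianceE; [|exact: cross_Lfun2..].
have M4 := moment4_component.
rewrite (expectationM_components (i := j) (ts_measurable ts) ind).
- by rewrite fineM ?subrr// expectation_fin_num// Lfun2_Lfun1// cross_Lfun2.
- by apply: sigma_measurableM; exact: component_sigma_measurable.
- by apply: sigma_measurableM; exact: component_other_measurable.
- by apply: Lfun2_Lfun1; exact: cross_Lfun2.
- by apply: Lfun2_Lfun1; exact: cross_Lfun2.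
- exact: moment4_mul4.
Qed.

(** If some index of [j, r, a, b] differs from the three others, the covariance
    vanishes, up to exchanging the roles of the indices, by [covariance_single].
    Otherwise the indices match in pairs, and the only pairing left by the
    hypothesis is [j = r], [a = b] with [a != j]. *)
Lemma covariance_unpaired t u j r a b :
  ~~ ((j == a) && (r == b) || (j == b) && (r == a)) ->
  fine (covariance P (cross s t j r) (cross s u a b)) = 0.
Proof.
move=> unpaired.
have [/and3P[]|Nj] := boolP [&& r != j, a != j & b != j].
  exact: covariance_single.
have [/and3P[]|Nr] := boolP [&& j != r, a != r & b != r].
  by rewrite crossC; exact: covariance_single.
have [/and3P[]|Na] := boolP [&& b != a, j != a & r != a].
  by rewrite covarianceC; exact: covariance_single.
have [/and3P[]|Nb] := boolP [&& a != b, j != b & r != b].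
  by rewrite covarianceC (crossC s u); exact: covariance_single.
have [<- <- aj] : [/\ j = r, a = b & a != j].
  have [jr|jr] := eqVneq j r.
    subst r; have [ab|ab] := eqVneq a b.
      subst b; split=> //.
      by apply: contraNneq unpaired => ->; rewrite eqxx.
    move: Na Nb; rewrite (eq_sym b a) ab /= !andbb !negbK => /eqP ja /eqP jb.
    by rewrite -ja -jb eqxx in ab.
  move: Nj Nr; rewrite (eq_sym r j) jr /= !negb_and !negbK.
  by case/orP=> /eqP h1 /orP[]/eqP h2; move: jr unpaired;
    rewrite -?h1 -?h2 !eqxx ?orbT.
exact: covariance_distinct.
Qed.
End independence.

(** * Diagonality and conclusion *)

(** If both factors of [c(j,r;a,b) c(k,r;a,b)] are nonzero, then
    [{j,r} = {a,b} = {k,r}] as multisets, which forces [j = k]. *)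
Lemma cum_kurtosis_diag {d : measure_display} {T : measurableType d}
    {R : realType} (P : probability T R) (m p : nat) (s : int -> T -> 'cV[R]_p) t :
  is_time_series P s -> centered P s -> independent_components P s ->
  is_diag_mx (cum_kurtosis P m s t).
Proof.
move=> ts cs ind; apply/is_diag_mxP => j k jk.
rewrite cum_kurtosis_crossE summxE big1 // => l _.
rewrite summxE big1 // => -[a b] _ /=.
rewrite mxE big1 // => r _; rewrite !mxE !outer_crossE.
have [paired|] := boolP ((j == a) && (r == b) || (j == b) && (r == a)).
  rewrite [X in _ * X]covariance_unpaired ?mulr0//.
  apply: contra_neqN jk => paired'; congr val; move: paired paired'.
  by case/orP=> /andP[/eqP-> /eqP->] /orP[]/andP[/eqP-> /eqP].
by move=> unpaired; rewrite covariance_unpaired// mul0r.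
Qed.

Theorem theorem4 (d : measure_display) (T : measurableType d) (R : realType)
    (P : probability T R) (m p : nat) (hm : (1 <= m)%N) (hp : (1 <= p)%N) :
  (forall x : int -> T -> 'cV[R]_p, is_time_series P x ->
     forall V : 'M[R]_p, orthogonal_mx V ->
     forall t : int,
       cum_kurtosis P m (mulmx_series V x) t =
       V *m cum_kurtosis P m x t *m V^T) /\
  (forall s : int -> T -> 'cV[R]_p, is_time_series P s ->
     centered P s -> independent_components P s ->
     forall t : int, is_diag_mx (cum_kurtosis P m s t)).
Proof.
split=> [x ts V oV t | s ts cs ind t].
  by apply: cum_kurtosis_equivariant => // v k; exact: moment4_component.
exact: cum_kurtosis_diag.
Qed.
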